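(* Consider a smooth fibration of $\mathbb{R}^3$ by oriented lines, given by a unit vector field $V$. Let $p\in\mathbb{R}^3$ be a point with fiber direction $u=V(p)$, and consider the local generating map $B:E\to\mathbb{R}^2$ of the fibration, defined in a neighborhood $E$ of $p$ in the translate of $u^\perp$ through $p$. Then $dB_p$ has no nonzero real eigenvalues. In particular: (a) If the fibration is nondegenerate at $p$, then the eigenvalues of $dB_p$ are complex (non-real). (b) Otherwise, both eigenvalues of $dB_p$ are zero.
   Context: A fibration of $\mathbb{R}^3$ by oriented lines is given by a unit vector field $V:\mathbb{R}^3\to S^2$ all of whose integral curves are oriented straight lines (the fibers); it is smooth if $V$ is smooth. It is nondegenerate at $p$ if the restriction of $\nabla V$ at $p$ to the plane $V(p)^\perp$ has rank $2$. Local generating map: let $p$ lie on a fiber with direction $u$. For a sufficiently small neighborhood $E$ of $p$ in the plane through $p$ orthogonal to $u$, there is a map $B:E\to\mathbb{R}^2$, where $\mathbb{R}^2$ is identified with the linear plane orthogonal to $u$, such that for each $q\in E$ the fiber through $q$ is the graph of the affine map $t\mapsto q+tB(q)$; that is, the fiber through $q$ is $\{q+t(B(q)+u) : t\in\mathbb{R}\}$. The differential $dB_p$ is regarded as a linear endomorphism of the linear plane orthogonal to $u$. *)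

(* Defs.v *)
(* R^3 is 'rV[R]_3 and linear maps act on row vectors from
   the right, so the differential of f at p is  v |-> v *m jacobian f p. *)
From HB Require Import structures.
From mathcomp Require Import all_boot all_order all_algebra.
From mathcomp Require Import all_classical all_reals all_analysis.
From mathcomp Require Import complex.
Set Implicit Arguments.
Unset Strict Implicit.
Unset Printing Implicit Defensive.
Import Order.TTheory GRing.Theory Num.Theory.
Import numFieldNormedType.Exports.
Local Open Scope classical_set_scope.
Local Open Scope ring_scope.

(* The library norm on row vectors is the sup norm, hence an explicit
   Euclidean inner product. *)
Definition dotv (R : realType) (n : nat) (x y : 'rV[R]_n) : R :=
  \sum_i x 0 i * y 0 i.

Definition eucl_norm (R : realType) (n : nat) (x : 'rV[R]_n) : R :=
  Num.sqrt (dotv x x).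

Fixpoint Ck (R : realType) (k m n : nat) (f : 'rV[R]_m -> 'rV[R]_n) : Prop :=
  match k with
  | 0 => continuous f
  | k'.+1 => (forall x, differentiable f x) /\
             (forall v : 'rV[R]_m, Ck k' (fun x => 'D_v f x))
  end.

Definition smooth (R : realType) (m n : nat) (f : 'rV[R]_m -> 'rV[R]_n) : Prop :=
  forall k, Ck k f.

(* Curves are defined on all of R: a smooth unit vector field is complete, so
   these are exactly its maximal integral curves, up to translating time. *)
Definition integral_curve (R : realType) (V : 'rV[R]_3 -> 'rV[R]_3)
    (g : R -> 'rV[R]_3) : Prop :=
  forall t : R, is_derive t (1 : R) g (V (g t)).

Definition straight_line (R : realType) (g : R -> 'rV[R]_3) : Prop :=
  exists a w : 'rV[R]_3, w != 0 /\ forall t, g t = a + t *: w.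

(* The second clause says that the fibers cover R^3; for smooth V it is the
   existence theorem for ordinary differential equations. *)
Definition line_fibration (R : realType) (V : 'rV[R]_3 -> 'rV[R]_3) : Prop :=
  [/\ forall p, eucl_norm (V p) = 1,
      forall p, exists2 g, integral_curve V g & g 0 = p
    & forall g, integral_curve V g -> straight_line g].

Definition fiber (R : realType) (V : 'rV[R]_3 -> 'rV[R]_3) (q : 'rV[R]_3) :
    set 'rV[R]_3 :=
  [set x | exists g, [/\ integral_curve V g, g 0 = q & exists t, g t = x]].

(* The rows of kermx (V p)^T span the plane orthogonal to V p. *)
Definition nondegenerate_at (R : realType) (V : 'rV[R]_3 -> 'rV[R]_3)
    (p : 'rV[R]_3) : Prop :=
  \rank (kermx (V p)^T *m jacobian V p) = 2%N.

(* The rows of W form an orthonormal basis of the plane orthogonal to u; the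
   isometry x |-> x *m W identifies R^2 with that plane. *)
Definition orthonormal_frame (R : realType) (u : 'rV[R]_3) (W : 'M[R]_(2, 3)) :
    Prop :=
  (forall i j, dotv (row i W) (row j W) = (i == j)%:R) /\
  (forall i, dotv (row i W) u = 0).

(* Both the neighborhood E of p in p + u^\perp and the values of B are read in
   the frame W: x stands for the point p + x *m W of the affine plane (so 0
   stands for p), and B x for the vector B x *m W of the linear plane. *)
Definition local_generating_map (R : realType) (V : 'rV[R]_3 -> 'rV[R]_3)
    (p : 'rV[R]_3) (W : 'M[R]_(2, 3)) (E : set 'rV[R]_2)
    (B : 'rV[R]_2 -> 'rV[R]_2) : Prop :=
  nbhs (0 : 'rV[R]_2) E /\
  forall x, E x ->
    fiber V (p + x *m W) =
    [set y | exists t : R, y = p + x *m W + t *: (B x *m W + V p)].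

(* Eigenvalues in the complexification, where a real 2 x 2 matrix has both. *)
Definition complex_eigenvalue (R : realType) (n : nat) (A : 'M[R]_n) (z : R[i]) :
    bool :=
  eigenvalue (map_mx (real_complex R) A) z.

(* Main.v *)
Require Import Defs.
From HB Require Import structures.
From mathcomp Require Import all_boot all_order all_algebra.
From mathcomp Require Import all_classical all_reals all_analysis.
From mathcomp Require Import complex.
Import Order.TTheory GRing.Theory Num.Theory.
Import numFieldNormedType.Exports.
Local Open Scope classical_set_scope.
Local Open Scope ring_scope.

(** The field V is constant on each fiber, so for every t
      V (q + t *: V q) = V q   for all q.
    Differentiating at q = p, with J the differential of V at p and J_t the
    one at the point p + t *: V p of the same fiber, gives
      J = (1 + t *: J) *m J_t
    ([jacobian_along_fiber]). If w *m J = a *: w with a != 0 and w != 0, then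
    t = - a^-1 makes w *m (1 + t *: J) vanish, so a *: w = 0: a contradiction.
    Geometrically, the fibers near p in the direction w would focus on the
    point at distance - a^-1 along the fiber of p, where V could not be smooth.
    So J has no nonzero real eigenvalue ([eigenvalue_jacobian_eq0]).

    It remains to compare dB with J. The fiber through q = p + x *m W has both
    directions V q and B x *m W + u, u = V p, and pairing with u fixes their
    ratio: dotv (V q) u *: B x = V q *m W^T. At x = 0 the scalar is 1 and B
    vanishes, so differentiating yields dB = W *m J *m W^T
    ([jacobian_generating_map]). As V is a unit field, the image of J is
    orthogonal to u, hence W *m J = dB *m W: in the frame W, dB is the
    restriction of J to the plane orthogonal to u. Therefore eigenvectors of
    dB are eigenvectors of J, and nondegeneracy means that dB is invertible.

    If dB is invertible, 0 is not an eigenvalue either, so no eigenvalue is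
    real. If it is singular, its characteristic polynomial is
    z (z - \tr dB), so the real number \tr dB is an eigenvalue, hence 0, and
    both roots are 0. *)

Set Implicit Arguments.
Unset Strict Implicit.

(** * Differentials of maps between row-vector spaces *)

(** A linear map out of row vectors is a finite sum of coordinate forms
    multiplied by fixed vectors. *)
Lemma linear_rV_continuous (R : realType) (m : nat) (U : normedModType R)
  (f : {linear 'rV[R]_m -> U}) : continuous f.
Proof.
have -> : (f : 'rV[R]_m -> U) = fun x => \sum_j x 0 j *: f (delta_mx 0 j).
  apply/funext => x; rewrite {1}[x]row_sum_delta linear_sum.
  by apply: eq_bigr => j _; rewrite linearZ.
move=> x; apply: differentiable_continuous.
have -> : (fun y : 'rV[R]_m => \sum_j y 0 j *: f (delta_mx 0 j)) =
    \sum_j (fun y : 'rV[R]_m => y 0 j *: f (delta_mx 0 j)).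
  by apply/funext => y; rewrite fct_sumE.
apply: differentiable_sum => j.
by apply: differentiableZl; exact: differentiable_coord.
Qed.

(** The values of f near x determine its first-order expansion, so the
    differential of g serves for f. A local generating map is determined by V
    only near 0, and is differentiated by means of this fact. *)
Lemma differentiable_near_eq (R : numFieldType) (U U' : normedModType R)
    (f g : U -> U') (x : U) : (\forall y \near x, f y = g y) ->
  differentiable g x -> differentiable f x.
Proof.
move=> fg dg.
have fgx : f x = g x by exact: nbhs_singleton fg.
suff dfo : f \o shift x = cst (f x) + 'd g x +o_ 0 id.
  apply/diff_locallyP; rewrite (@diff_unique _ _ _ f ('d g x) x) //.
    by split => //; exact: diff_continuous.
  exact: diff_continuous.
apply/eqaddoP => e e0.
have /eqaddoP/(_ e e0) := diff_locally dg.
move: fg; rewrite (near_shift 0) => fg dgo.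
near=> h.
have -> : (f \o shift x - (cst (f x) + 'd g x)) h =
          (g \o shift x - (cst (g x) + 'd g x)) h.
  rewrite !fctE /= fgx; congr (_ - _).
  by near: h; move: fg; rewrite subr0.
by near: h.
Unshelve. all: by end_near. Qed.

Lemma jacobian_comp (R : realType) (l m n : nat) (f : 'rV[R]_l -> 'rV[R]_m)
    (g : 'rV[R]_m -> 'rV[R]_n) (x : 'rV[R]_l) :
  differentiable f x -> differentiable g (f x) ->
  jacobian (g \o f) x = jacobian f x *m jacobian g (f x).
Proof.
move=> df dg; apply/row_matrixP => i.
rewrite [in RHS]rowE mulmxA !rowE !mul_rV_lin1.
by rewrite diff_comp.
Qed.

Lemma is_diff_affine (R : realType) (m n : nat) (A : 'M[R]_(m, n)) a x :
  is_diff x (fun y : 'rV_m => a + y *m A) (mulmxr A : 'rV_m -> 'rV_n).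
Proof.
have cA : continuous (mulmxr A : 'rV_m -> 'rV_n) by exact: linear_rV_continuous.
have dA : is_diff x (mulmxr A : 'rV_m -> 'rV_n) (mulmxr A : 'rV_m -> 'rV_n).
  by apply: DiffDef; [exact: linear_differentiable|exact: diff_lin].
have := is_diffD (is_diff_cst a x) dA; rewrite add0r; exact.
Qed.

Lemma differentiable_affine (R : realType) (m n : nat) (A : 'M[R]_(m, n)) a x :
  differentiable (fun y : 'rV_m => a + y *m A) x.
Proof. by have dA := is_diff_affine A a x; exact: ex_diff. Qed.

Lemma jacobian_affine (R : realType) (m n : nat) (A : 'M[R]_(m, n)) a x :
  jacobian (fun y : 'rV_m => a + y *m A) x = A.
Proof.
apply/row_matrixP => i; have dA := is_diff_affine A a x.
by rewrite !rowE mul_rV_lin1 diff_val.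
Qed.

(** As k *: B = G near x, B is k^-1 *: G there; and in the product rule for
    k *: B the term that differentiates k carries the factor B x = 0, so the
    derivative of k never enters. *)
Lemma jacobian_unscale (R : realType) (m n : nat) (k : 'rV[R]_m -> R)
    (B G : 'rV[R]_m -> 'rV[R]_n) x :
  (\forall y \near x, k y *: B y = G y) ->
  differentiable k x -> differentiable G x -> k x != 0 -> B x = 0 ->
  differentiable B x /\ k x *: jacobian B x = jacobian G x.
Proof.
move=> kBG dk dG kx0 Bx0.
have k0 : \forall y \near x, k y != 0.
  have kc : k y @[y --> x] --> k x by exact: differentiable_continuous.
  exact: cvgr_neq0 kc kx0.
have dcoord (F : 'rV[R]_m -> 'rV[R]_n) j :
    differentiable F x -> differentiable (fun y => F y 0 j) x.
  by move=> dF; exact: (differentiable_comp dF (differentiable_coord (F x) 0 j)).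
have dB : differentiable B x.
  pose F j y : 'rV[R]_n := ((k y)^-1 * G y 0 j) *: delta_mx 0 j.
  apply: (@differentiable_near_eq _ _ _ B (\sum_j F j)).
    near=> y; have ky0 : k y != 0 by near: y.
    rewrite fct_sumE [LHS]row_sum_delta; apply: eq_bigr => j _.
    rewrite /F; have <- : k y *: B y = G y by near: y.
    by rewrite mxE mulKf.
  apply: differentiable_sum => j; apply: differentiableZl.
  apply: differentiableM; last exact: dcoord.
  exact: differentiableV.
split=> //; apply/matrixP => i j.
rewrite [LHS]mxE; pose v : 'rV[R]_m := delta_mx 0 i.
have JE (F : 'rV[R]_m -> 'rV[R]_n) : differentiable F x ->
    jacobian F x i j = 'D_v (fun y => F y 0 j) x.
  move=> dF; transitivity ('D_v F x 0 j); last first.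
    by rewrite derive_mx ?mxE //; exact: diff_derivable.
  by rewrite deriveEjacobian // -rowE [RHS]mxE.
apply: (etrans (congr1 ( *%R (k x)) (JE B dB))).
apply: etrans (esym (JE G dG)).
have kBGj : \forall y \near x, (k * (fun y => B y 0 j)) y = G y 0 j.
  near=> y; have <- : k y *: B y = G y by near: y.
  by rewrite mxE.
rewrite -(near_eq_derive _ kBGj) deriveM; first last.
- exact/diff_derivable/dcoord.
- exact: diff_derivable.
by rewrite Bx0 mxE scale0r addr0.
Unshelve. all: by end_near. Qed.

(** * Eigenvalues of real and 2 x 2 matrices *)

Lemma eigenvalue_2x2 (F : fieldType) (A : 'M[F]_2) (a : F) :
  eigenvalue A a = (a ^+ 2 - \tr A * a + \det A == 0).
Proof.
rewrite eigenvalue_root_char rootE horner_coef size_char_poly.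
rewrite !big_ord_recl big_ord0 /=.
rewrite char_poly_det (@char_poly_trace _ 2) //.
have /monicP := char_poly_monic A; rewrite lead_coefE size_char_poly /= => ->.
rewrite expr0 expr1 addr0 mulr1 mul1r sqrrN expr1n mul1r.
by rewrite addrC addrAC addrC !addrA mulNr.
Qed.

(** The characteristic polynomial commutes with the field embedding. *)
Lemma eigenvalue_real_complex (R : realType) (n : nat) (A : 'M[R]_n) (a : R) :
  complex_eigenvalue A (real_complex R a) = eigenvalue A a.
Proof.
by rewrite /complex_eigenvalue !eigenvalue_root_char -map_char_poly fmorph_root.
Qed.

(** * Unit vector fields and orthonormal frames *)

Lemma dotvE (R : realType) (n : nat) (x y : 'rV[R]_n) :
  dotv x y = (x *m y^T) 0 0.
Proof. by rewrite /dotv mxE; apply: eq_bigr => i _; rewrite mxE. Qed.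

Lemma dotv_eucl_norm1 (R : realType) (n : nat) (x : 'rV[R]_n) :
  eucl_norm x = 1 -> dotv x x = 1.
Proof.
move=> x1; have xx : 0 <= dotv x x by apply: sumr_ge0 => i _; exact: sqr_ge0.
by rewrite -(sqr_sqrtr xx) -/(eucl_norm x) x1 expr1n.
Qed.

(** Derivative of the constant function |V|^2 = 1. *)
Lemma jacobian_unit_field_normal (R : realType) (m n : nat)
    (V : 'rV[R]_m -> 'rV[R]_n) p :
  (forall x, eucl_norm (V x) = 1) -> differentiable V p ->
  jacobian V p *m (V p)^T = 0.
Proof.
move=> V1 dV; apply/row_matrixP => i; rewrite row0 rowE mulmxA.
rewrite -deriveEjacobian //; set v := delta_mx _ _.
have dVj j : is_derive p v (fun x => V x 0 j) ('D_v V p 0 j).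
  have Vpv : derivable V p v by exact: diff_derivable.
  apply: DeriveDef; first by move/derivable_mxP : Vpv; exact.
  by rewrite derive_mx // mxE.
have : 'D_v (fun x => dotv (V x) (V x)) p = 0.
  have -> : (fun x => dotv (V x) (V x)) = cst 1.
    by apply/funext => x; rewrite dotv_eucl_norm1.
  exact: derive_cst.
have -> : (fun x => dotv (V x) (V x)) =
    \sum_j ((fun x => V x 0 j) * (fun x => V x 0 j)).
  by apply/funext => x; rewrite fct_sumE.
rewrite derive_val.
under eq_bigr do rewrite -mulr2n.
rewrite sumrMnl => /eqP; rewrite mulrn_eq0 /= => /eqP dVV.
apply/rowP => k; rewrite ord1 -dotvE mxE -[RHS]dVV.
by apply: eq_bigr => j _; rewrite mulrC.
Qed.

Section Frame.
Variables (R : realType) (u : 'rV[R]_3) (W : 'M[R]_(2, 3)).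
Hypotheses (uu : dotv u u = 1) (frameW : orthonormal_frame u W).

Lemma frame_mulmx_tr : W *m W^T = 1%:M.
Proof.
apply/matrixP => i j; rewrite mxE [RHS]mxE -frameW.1.
by apply: eq_bigr => k _; rewrite !mxE.
Qed.

Lemma frame_mulmx_normal : W *m u^T = 0.
Proof.
apply/colP => i; rewrite [RHS]mxE -[RHS](frameW.2 i) dotvE.
by rewrite -row_mul [RHS]mxE.
Qed.

Lemma normal_mulmx_frame : u *m W^T = 0.
Proof. by rewrite -[LHS]trmxK trmx_mul trmxK frame_mulmx_normal trmx0. Qed.

Lemma normal_mulmx_tr : u *m u^T = 1%:M.
Proof. by apply/rowP => i; rewrite ord1 -dotvE uu mxE. Qed.

(** The square matrix with rows W and u is orthogonal, so its transpose is
    also a left inverse; in block form, this is the resolution of the identity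
    into the projections onto the plane and onto its normal. *)
Lemma frame_complete : W^T *m W + u^T *m u = 1%:M.
Proof.
pose M := col_mx W u.
have : M *m M^T = 1%:M.
  rewrite tr_col_mx mul_col_row frame_mulmx_tr frame_mulmx_normal.
  by rewrite normal_mulmx_frame normal_mulmx_tr -scalar_mx_block.
by move/mulmx1C; rewrite tr_col_mx mul_row_col.
Qed.

Lemma mulmx_frameK (n : nat) (A : 'M[R]_(n, 3)) :
  A *m u^T = 0 -> A *m W^T *m W = A.
Proof.
by move=> Au; rewrite -[RHS]mulmx1 -frame_complete mulmxDr !mulmxA Au mul0mx addr0.
Qed.

Lemma rank_normal_plane (n : nat) (A : 'M[R]_(3, n)) :
  \rank (kermx u^T *m A) = \rank (W *m A).
Proof.
have kerW : (kermx u^T :=: W)%MS.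
  apply/eqmxP/andP; split; last exact/sub_kermxP/frame_mulmx_normal.
  by rewrite -(mulmx_frameK (mulmx_ker u^T)) submxMl.
by rewrite (eqmxMr A kerW).
Qed.
End Frame.

(** * The differential of a line fibration along a fiber *)

(** An affine integral curve has constant velocity, and its velocity is V. *)
Lemma integral_curve_fibration (R : realType) (V : 'rV[R]_3 -> 'rV[R]_3) g :
  line_fibration V -> integral_curve V g ->
  forall t, g t = g 0 + t *: V (g 0) /\ V (g t) = V (g 0).
Proof.
case=> _ _ lineV Vg; have [a [w [_ gE]]] := lineV _ Vg.
have dg t : V (g t) = w.
  have [_ <-] := Vg t.
  have -> : g = cst a + *:%R^~ w by apply/funext => s; rewrite gE.
  have dw : is_derive t (1 : R) (cst a + *:%R^~ w) (0 + w).
    apply: is_deriveD.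
    apply: DeriveDef; first exact: diff_derivable.
    by rewrite deriveE // diff_val scale1r.
  by rewrite derive_val add0r.
by move=> t; rewrite !dg !gE scale0r addr0.
Qed.

Lemma const_along_fiber (R : realType) (V : 'rV[R]_3 -> 'rV[R]_3) q t :
  line_fibration V -> V (q + t *: V q) = V q.
Proof.
move=> fibV; have [_ /(_ q)[g Vg <-] _] := fibV.
have [gt VV] := integral_curve_fibration fibV Vg t.
by rewrite -gt.
Qed.

(** Chain rule applied to the identity V (q + t *: V q) = V q. *)
Lemma jacobian_along_fiber (R : realType) (V : 'rV[R]_3 -> 'rV[R]_3) p t :
  line_fibration V -> (forall x, differentiable V x) ->
  jacobian V p = (1%:M + t *: jacobian V p) *m jacobian V (p + t *: V p).
Proof.
move=> fibV dV; pose G q := q + t *: V q.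
have dG : is_diff p G (id + t *: ('d V p : _ -> _)).
  have := differentiableP (dV p) => ?.
  have -> : G = id + t *: V by [].
  exact: is_diffD.
have -> : 1%:M + t *: jacobian V p = jacobian G p.
  apply/row_matrixP => i.
  rewrite !rowE mulmxDr mulmx1 -scalemxAr.
  rewrite [in LHS]mul_rV_lin1.
  rewrite [in RHS]mul_rV_lin1.
  by rewrite [in RHS]diff_val.
have dGp : differentiable G p by exact: ex_diff.
have VG : V \o G = V by apply/funext => q; exact: const_along_fiber.
have JVG := jacobian_comp dGp (dV (G p)).
by rewrite VG in JVG.
Qed.

(** Fibers near p that spread linearly at the rate a in the direction w would
    meet, to first order, the fiber of p at time - a^-1. *)
Lemma eigenvalue_jacobian_eq0 (R : realType) (V : 'rV[R]_3 -> 'rV[R]_3) p a :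
  line_fibration V -> (forall x, differentiable V x) ->
  eigenvalue (jacobian V p) a -> a = 0.
Proof.
move=> fibV dV /eigenvalueP[w wJ w0]; apply/eqP/negPn/negP => a0.
(* t = - a^-1 is the time at which w *m (1 + t *: J) = (1 + t * a) *: w is 0. *)
have := congr1 (mulmx w) (jacobian_along_fiber p (- a^-1) fibV dV).
rewrite mulmxA mulmxDr mulmx1 -scalemxAr wJ scalerA mulNr mulVf // scaleN1r.
by rewrite subrr mul0mx => /eqP; rewrite scaler_eq0 (negPf a0) (negPf w0).
Qed.

(** * The local generating map *)

Section GeneratingMap.
Variables (R : realType) (V : 'rV[R]_3 -> 'rV[R]_3) (p : 'rV[R]_3).
Variables (W : 'M[R]_(2, 3)) (E : set 'rV[R]_2) (B : 'rV[R]_2 -> 'rV[R]_2).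
Hypotheses (fibV : line_fibration V) (frameW : orthonormal_frame (V p) W).
Hypotheses (genB : local_generating_map V p W E B).

Let uu : dotv (V p) (V p) = 1.
Proof. by apply: dotv_eucl_norm1; case: fibV. Qed.

(** With q = p + x *m W, the point of the graph at time 1 lies on the fiber of
    q, all of whose points are of the form q + c *: V q. *)
Lemma generating_map_parallel x : E x ->
  exists c, B x *m W + V p = c *: V (p + x *m W).
Proof.
move=> Ex; have := genB.2 x Ex => /seteqP[_ /(_ (p + x *m W + (B x *m W + V p)))] /=.
case; first by exists 1; rewrite scale1r.
move=> g [Vg g0 [t]]; rewrite (integral_curve_fibration fibV Vg t).1 g0.
by move=> /addrI <-; exists t.
Qed.

(** Splitting the proportionality B x *m W + V p = c *: V q along the plane
    and its normal: the normal component gives c = (dotv (V q) (V p))^-1. *)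
Lemma generating_mapE x : E x ->
  dotv (V (p + x *m W)) (V p) *: B x = V (p + x *m W) *m W^T.
Proof.
move=> /generating_map_parallel[c BE].
have : (B x *m W + V p) *m W^T = B x.
  rewrite mulmxDl -mulmxA (frame_mulmx_tr frameW) (normal_mulmx_frame frameW).
  by rewrite addr0 mulmx1.
have : dotv (B x *m W + V p) (V p) = 1.
  rewrite dotvE mulmxDl -mulmxA (frame_mulmx_normal frameW) mulmx0 add0r -dotvE.
  exact: uu.
rewrite BE dotvE -!scalemxAl mxE -dotvE => c1 <-.
by rewrite scalerA mulrC c1 scale1r.
Qed.

(** [jacobian_unscale] at x = 0, where the scalar factor is |V p|^2 = 1. *)
Lemma jacobian_generating_map : differentiable V p ->
  differentiable B 0 /\ jacobian B 0 = W *m jacobian V p *m W^T.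
Proof.
move=> dV; pose h (x : 'rV[R]_2) := p + x *m W.
have h0 : h 0 = p by rewrite /h mul0mx addr0.
have dh : differentiable h 0 by exact: differentiable_affine.
have dVp : differentiable V (h 0) by rewrite h0.
have dVh : differentiable (V \o h) 0 by exact: differentiable_comp.
have JVh : jacobian (V \o h) 0 = W *m jacobian V p.
  have := jacobian_comp dh dVp.
  by rewrite h0 (jacobian_affine W p 0 : jacobian h 0 = W).
(* The offset 0 makes this linear map an instance of the affine case. *)
pose T (y : 'rV[R]_3) := 0 + y *m W^T.
have dT : differentiable T ((V \o h) 0) by exact: differentiable_affine.
pose G := T \o (V \o h).
have GE x : G x = V (h x) *m W^T by rewrite /G /T /= add0r.
have dG : differentiable G 0 by exact: differentiable_comp.
have JG : jacobian G 0 = W *m jacobian V p *m W^T.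
  have := jacobian_comp dVh dT.
  by rewrite JVh (jacobian_affine W^T 0 _ : jacobian T ((V \o h) 0) = W^T).
pose k x := dotv (V (h x)) (V p).
have dk : differentiable k 0.
  have dF : differentiable (fun y : 'rV_3 => 0 + y *m (V p)^T) ((V \o h) 0).
    by exact: differentiable_affine.
  have := differentiable_comp (differentiable_comp dVh dF)
    (differentiable_coord _ 0 0).
  by congr (differentiable _ _); apply/funext => x; rewrite /= add0r -dotvE.
have kBG : \forall x \near (0 : 'rV[R]_2), k x *: B x = G x.
  apply: filterS genB.1 => x Ex.
  by rewrite GE; exact: generating_mapE.
have k0 : k 0 = 1 by rewrite /k h0 uu.
have B0 : B 0 = 0.
  have := nbhs_singleton kBG.
  by rewrite k0 scale1r GE h0 (normal_mulmx_frame frameW).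
have [dB] := jacobian_unscale kBG dk dG (eq_ind_r (fun z => z != 0) (oner_neq0 _) k0) B0.
by rewrite k0 scale1r JG.
Qed.

End GeneratingMap.

Unset Implicit Arguments.
Set Strict Implicit.

Theorem theorem4 (R : realType) (V : 'rV[R]_3 -> 'rV[R]_3)
    (smoothV : smooth V) (fibV : line_fibration V)
    (p : 'rV[R]_3) (W : 'M[R]_(2, 3)) (frameW : orthonormal_frame (V p) W)
    (E : set 'rV[R]_2) (B : 'rV[R]_2 -> 'rV[R]_2)
    (genB : local_generating_map V p W E B) :
  differentiable B (0 : 'rV[R]_2) /\
  let dB := jacobian B (0 : 'rV[R]_2) in
  [/\ forall a : R, eigenvalue dB a -> a = 0,
      nondegenerate_at V p ->
        forall z : R[i], complex_eigenvalue dB z -> complex.Im z != 0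
    & ~ nondegenerate_at V p ->
        forall z : R[i], complex_eigenvalue dB z -> z = 0].
Proof.
have dV x : differentiable V x by case: (smoothV 1%N).
have [dB JB] := jacobian_generating_map fibV frameW genB (dV p).
split=> //; set A := jacobian B 0; move: JB; rewrite -/A => JB.
have V1 : forall x, eucl_norm (V x) = 1 by case: fibV.
have uu : dotv (V p) (V p) = 1 by exact: dotv_eucl_norm1.
(* W is an isometry onto the plane orthogonal to V p, which contains the image
   of the differential of V, so dropping the projection W^T *m W loses nothing. *)
have WJ : W *m jacobian V p = A *m W.
  rewrite JB (mulmx_frameK uu frameW) // -mulmxA jacobian_unit_field_normal //.
  exact: mulmx0.
have real_eigen a : eigenvalue A a -> a = 0.
  move=> /eigenvalueP[v vA v0]; apply: (eigenvalue_jacobian_eq0 (p := p) fibV dV).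
  apply/eigenvalueP; exists (v *m W).
    by rewrite -mulmxA WJ mulmxA vA scalemxAl.
  apply: contraNneq v0 => vW0.
  by rewrite -[v]mulmx1 -(frame_mulmx_tr frameW) mulmxA vW0 mul0mx.
have nondegE : nondegenerate_at V p <-> A \in unitmx.
  rewrite /nondegenerate_at (rank_normal_plane uu frameW) WJ mxrankMfree.
    by rewrite -row_free_unit; split=> /eqP.
  by apply/row_freeP; exists W^T; exact: (frame_mulmx_tr frameW).
have not_unit a : eigenvalue A a -> A \in unitmx -> False.
  move=> /[dup] /real_eigen -> /eigenvalueP[v]; rewrite scale0r => vA v0 uA.
  by move: v0; rewrite -(mulmxK uA v) vA mul0mx eqxx.
split=> //.
  move=> /nondegE uA [x y] Axy; apply/eqP => /= y0; apply: (not_unit x) uA.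
  by move: Axy; rewrite y0 -eigenvalue_real_complex.
move=> nd z; have /eqP detA : \det A == 0.
  by apply/negPn/negP; rewrite -unitfE -unitmxE => /nondegE.
(* For det A = 0 the second root of the characteristic polynomial is the trace,
   which is real. *)
have /real_eigen trA : eigenvalue A (\tr A).
  by rewrite eigenvalue_2x2 detA addr0 expr2 subrr.
rewrite /complex_eigenvalue eigenvalue_2x2 det_map_mx detA rmorph0 addr0.
by rewrite trace_map_mx trA rmorph0 mul0r subr0 expf_eq0 /= => /eqP.
Qed.
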